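(* Let $P$ be a standard Young tableau with exactly two columns, and suppose that for some integer $k$ three consecutive rows of $P$ (from top to bottom) are $(k-2,\,k-1)$, $(k,\,k+1)$ and $(k+2,\,k+3)$ (the other rows of $P$, above or below, being arbitrary). Then all elements of the Kazhdan--Lusztig right cell $\mathcal{C}_R(P)$ are non-smooth. In fact, every element of $\mathcal{C}_R(P)$ contains the subsequence $(k+2,k,k+1,k-1)$, which has the pattern $4231$.
   Context: Permutations $w\in S_n$ are written in one-line notation $w=(w_1,\dots,w_n)$; a subsequence of $w$ is a list of entries of $w$ in the order in which they occur (not necessarily adjacent). $P(w)$ denotes the Robinson--Schensted (row) insertion tableau of $w$. Two elements of $S_n$ are in the same Kazhdan--Lusztig right cell if and only if they have the same insertion tableau; for a standard Young tableau $P$ with $n$ boxes, $\mathcal{C}_R(P)=\{w\in S_n: P(w)=P\}$ is the corresponding right cell. An element $w\in S_n$ contains the pattern $3412$ (resp. $4231$) if there are indices $a<b<c<d$ with $w_c<w_d<w_a<w_b$ (resp. $w_d<w_b<w_c<w_a$). The element $w$ is smooth if the Schubert variety $X_w=\overline{BwB/B}$ of type $A$ is smooth; equivalently, if $w$ contains neither $3412$ nor $4231$. *)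

(* Defs.v *)
From mathcomp Require Import all_boot all_order all_algebra all_fingroup.
From mathcomp Require Import mpoly.

Set Implicit Arguments.
Unset Strict Implicit.
Unset Printing Implicit Defensive.

Import GRing.Theory.

(* ** Tableaux and Robinson-Schensted insertion *)

(* A tableau is the list of its rows, from top to bottom. *)
Definition tableau := seq (seq nat).

(* [row_insert x r] is the new row together with the entry bumped out of it:
   the leftmost entry larger than [x], if there is one. *)
Fixpoint row_insert (x : nat) (r : seq nat) : seq nat * option nat :=
  if r is y :: r' then
    if x < y then (x :: r', Some y)
    else let: (r'', b) := row_insert x r' in (y :: r'', b)
  else ([:: x], None).

Fixpoint tab_insert (x : nat) (t : tableau) : tableau :=
  if t is r :: t' then
    let: (r', b) := row_insert x r in
    if b is Some y then r' :: tab_insert y t' else r' :: t'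
  else [:: [:: x]].

Definition insertion_tableau (s : seq nat) : tableau :=
  foldl (fun t x => tab_insert x t) [::] s.

Definition ncols (t : tableau) : nat := size (head [::] t).

Definition is_syt (n : nat) (t : tableau) : Prop :=
  [/\ (forall r, r \in t -> r != [::]),
      sorted geq (map size t),
      (forall r, r \in t -> sorted ltn r),
      (forall i j, i.+1 < size t -> j < size (nth [::] t i.+1) ->
         nth 0 (nth [::] t i) j < nth 0 (nth [::] t i.+1) j)
    & perm_eq (flatten t) (iota 1 n)].

(* ['S_n] permutes {0, ..., n-1}; the one-line notation uses {1, ..., n}. *)
Definition one_line (n : nat) (w : 'S_n) : seq nat :=
  [seq (val (w i)).+1 | i <- enum 'I_n].

Definition right_cell (n : nat) (P : tableau) : {set 'S_n} :=
  [set w | insertion_tableau (one_line w) == P].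

(* The entries of [s] are in the same relative order as those of [p]. *)
Definition has_pattern (s p : seq nat) : Prop :=
  size s = size p /\
  forall i j, i < size s -> j < size s ->
    (nth 0 s i < nth 0 s j) = (nth 0 p i < nth 0 p j).

(* ** Zariski topology and nonsingularity in affine space *)

Local Open Scope ring_scope.

Section Affine.

Variables (K : closedFieldType) (N : nat).

Definition zset := 'rV[K]_N -> Prop.

Definition evalp (p : {mpoly K[N]}) (x : 'rV[K]_N) : K :=
  p.@[fun i => x 0 i].

Definition vanishes_on (p : {mpoly K[N]}) (A : zset) : Prop :=
  forall x, A x -> evalp p x = 0.

Definition zclosure (A : zset) : zset :=
  fun x => forall p, vanishes_on p A -> evalp p x = 0.

Definition zsub (A B : zset) : Prop := forall x, A x -> B x.

Definition zclosed (A : zset) : Prop := zsub (zclosure A) A.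

Definition zirreducible (A : zset) : Prop :=
  (exists x, A x) /\
  forall C D : zset, zclosed C -> zclosed D ->
    (forall x, A x -> C x \/ D x) -> zsub A C \/ zsub A D.

(* x \in Z 0 < Z 1 < ... < Z m <= A, with every Z i closed and irreducible *)
Definition irr_chain (A : zset) (x : 'rV[K]_N) (m : nat) : Prop :=
  exists Z : nat -> zset,
    [/\ (forall i, (i <= m)%N -> zclosed (Z i) /\ zirreducible (Z i)),
        (forall i, (i < m)%N -> zsub (Z i) (Z i.+1) /\ ~ zsub (Z i.+1) (Z i)),
        Z 0%N x
      & zsub (Z m) A].

(* [d] is the Krull dimension of the local ring of the closed set [A] at [x]. *)
Definition has_local_dim (A : zset) (x : 'rV[K]_N) (d : nat) : Prop :=
  irr_chain A x d /\ forall m, irr_chain A x m -> (m <= d)%N.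

Definition tangent (A : zset) (x : 'rV[K]_N) : zset :=
  fun v => forall p, vanishes_on p A -> \sum_i evalp p^`M(i) x * v 0 i = 0.

Definition has_tangent_dim (A : zset) (x : 'rV[K]_N) (d : nat) : Prop :=
  exists T : 'M[K]_(d, N),
    row_free T /\ forall v : 'rV[K]_N, (v <= T)%MS <-> tangent A x v.

Definition nonsingular_at (A : zset) (x : 'rV[K]_N) : Prop :=
  exists d, has_local_dim A x d /\ has_tangent_dim A x d.

End Affine.

(* ** Schubert varieties in GL_n / B *)

Section Schubert.

Variables (K : closedFieldType) (n : nat).

Definition in_borel (b : 'M[K]_n) : Prop :=
  b \in unitmx /\ forall i j : 'I_n, (j < i)%N -> b i j = 0.

Definition in_opp_unipotent (u : 'M[K]_n) : Prop :=
  forall i j : 'I_n, (i <= j)%N -> u i j = (i == j)%:R.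

(* The matrix sending the basis (column) vector e_j to e_(w j); note that
   mathcomp's [perm_mx w] is its transpose. *)
Definition perm_matrix (w : 'S_n) : 'M[K]_n := \matrix_(i, j) (i == w j)%:R.

Definition bruhat_cell (w : 'S_n) (g : 'M[K]_n) : Prop :=
  exists b c, [/\ in_borel b, in_borel c & g = b *m perm_matrix w *m c].

(* Subsets of GL_n / B are represented by their preimages in GL_n.  As
   GL_n -> GL_n / B is open, the preimage of the closure of BwB/B is the closure
   of BwB in GL_n.  Matrices are points of affine space through [mxvec]. *)
Definition schubert (w : 'S_n) (g : 'M[K]_n) : Prop :=
  g \in unitmx /\ zclosure (fun x => bruhat_cell w (vec_mx x)) (mxvec g).

(* The map u |-> g u B identifies the lower unitriangular matrices, an affine
   space, with an open neighbourhood of gB in GL_n / B, and 1 with gB; this is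
   the trace of X_w in that chart, a closed subset of affine space. *)
Definition schubert_chart (w : 'S_n) (g : 'M[K]_n) : zset K (n * n) :=
  fun x => in_opp_unipotent (vec_mx x) /\ schubert w (g *m vec_mx x).

Definition smooth (w : 'S_n) : Prop :=
  forall g : 'M[K]_n, schubert w g ->
    nonsingular_at (schubert_chart w g) (mxvec 1%:M).

End Schubert.

(* Main.v *)
Require Import Defs.
From mathcomp Require Import all_boot all_order all_algebra all_fingroup.
From mathcomp Require Import mpoly zify ring.
From Stdlib Require Import Classical_Prop.

Set Implicit Arguments.
Unset Strict Implicit.
Unset Printing Implicit Defensive.

(** Both halves rest on the fact that the six values [k - 2, ..., k + 3] fill three
    full consecutive rows.

    Combinatorics. A word is plactically (Knuth) equivalent to the reading word
    of its insertion tableau, and plactic equivalence survives restriction to an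
    interval of values. Restricting to [k - 2, ..., k + 3] therefore shows that
    the corresponding subword of [w] is equivalent to the reading word of the
    three rows, a shift of 563412. The plactic class of 563412 has five elements,
    and 5342 is a subword of each of them. See [knuth_insertion_tableau],
    [knuth_filter_interval] and [subseq_of_insertion_tableau].

    Geometry. The values of this occurrence of 4231 are consecutive. Let [v] be
    [w] with the occurrence replaced by 2143. In the chart of the flag variety
    centred at the torus fixed point [v], the Schubert variety of [w] contains the
    coordinate line of the positions [i < j] as soon as [v j < v i], or [i] and
    [j] both belong to the pattern: in the second case, by an SL_2 computation,
    it is enough that [v] composed with the transposition of [i] and [j] be
    reached from [w] by transpositions removing an inversion. As the values of
    the pattern are consecutive, [v] and [w] have the same inversions outside the
    pattern, whereas inside it there are six lines for the five inversions of
    4231. So the tangent space at [v] has dimension at least one more than the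
    number of inversions of [w].

    On the other hand every chain of irreducible closed subsets of a chart has at
    most as many steps as [w] has inversions ([schubert_chart_dim]). A chain with
    [m] steps provides [m] algebraically independent polynomial functions on its
    top: at each step one adds a function that vanishes on the smaller set but
    not on the larger one ([chain_alg_independent]). The coordinates of the chart
    are ratios of minors that are invariant under the Borel subgroup, and the
    Bruhat cell modulo the Borel subgroup is an affine space with one coordinate
    for each inversion; so functions on the chart become rational functions in
    that many variables, and a count of monomials bounds the number of
    independent ones ([alg_dependent], [irr_chain_leq]). *)

(** * Knuth equivalence *)

(** With these weak inequalities the moves make sense for words with repeated
    letters, and no distinctness has to be carried through the insertion. *)
Inductive knuth_triple : seq nat -> seq nat -> Prop :=
| KnuthYZX x y z of x < y & y <= z : knuth_triple [:: y; z; x] [:: y; x; z]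
| KnuthXZY x y z of x <= y & y < z : knuth_triple [:: x; z; y] [:: z; x; y].

Inductive knuth : seq nat -> seq nat -> Prop :=
| KnuthRefl s : knuth s s
| KnuthSym s t of knuth s t : knuth t s
| KnuthTrans s t u of knuth s t & knuth t u : knuth s u
| KnuthMove u v a b of knuth_triple a b : knuth (u ++ a ++ v) (u ++ b ++ v).

Lemma knuth_cat2 u v s t : knuth s t -> knuth (u ++ s ++ v) (u ++ t ++ v).
Proof.
elim=> {s t} [s|s t _|s t r _ IH1 _|u' v' a b ab].
- exact: KnuthRefl.
- exact: KnuthSym.
- exact: KnuthTrans IH1.
- rewrite -!catA !(catA u u'); exact: KnuthMove.
Qed.

Lemma knuth_catl u s t : knuth s t -> knuth (u ++ s) (u ++ t).
Proof. by move=> /(knuth_cat2 u [::]); rewrite !cats0. Qed.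

Lemma knuth_catr v s t : knuth s t -> knuth (s ++ v) (t ++ v).
Proof. exact: (@knuth_cat2 [::]). Qed.

(** ** Insertion is a sequence of plactic moves *)

(** The inserted letter travels left, each move being witnessed by the entry to
    the left of the one that it passes; it stops behind the entry it bumps, which
    has no such witness. *)
Lemma knuth_travel x z r :
  x < z -> sorted leq (z :: r) -> knuth (z :: r ++ [:: x]) [:: z, x & r].
Proof.
elim: r z => [|a r IHr] z xz /=; first by move=> _; apply: KnuthRefl.
case/andP=> za ar; have xa := leq_trans xz za.
apply: (KnuthTrans (t := [:: z, a, x & r])).
  exact: (knuth_catl [:: z] (IHr a xa ar)).
exact: (@KnuthMove [::] r _ _ (KnuthYZX xz za)).
Qed.

Lemma row_insert_sorted z x r :
  z <= x -> path leq z r -> path leq z (row_insert x r).1.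
Proof.
elim: r z => [|a r IHr] z zx /=; first by rewrite zx.
case/andP=> za ar; case: ltnP => /= [xa|ax].
  rewrite zx /=; case: r ar {IHr} => //= b r /andP[ab ->].
  by rewrite andbT; apply: leq_trans ab; apply: ltnW.
by case E: (row_insert x r) => [r' b] /=; rewrite za -[r']/(r', b).1 -E IHr.
Qed.

(** Once the inserted letter has reached its place, the bumped letter travels
    left past the smaller entries, each move being witnessed by the entry that
    follows. *)
Lemma knuth_row_insert x r : sorted leq r ->
  let: (r', b) := row_insert x r in
  knuth (rcons r x) (if b is Some y then y :: r' else r').
Proof.
elim: r => [|z r IHr] /=; first by move=> _; apply: KnuthRefl.
move=> zr; case: ltnP => [xz|zx].
  rewrite -rcons_cons -cats1; exact: knuth_travel.
have := IHr (path_sorted zr).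
have := row_insert_sorted zx zr.
case E: (row_insert x r) => [r' [y|]] /= zr' {}IHr; last first.
  exact: (knuth_catl [:: z] IHr).
(* [h], the head of the new row, lies between [z] and the bumped letter *)
have [h [t [r'E hy]]] : exists h t, r' = h :: t /\ h < y.
  case: r E {IHr zr zr'} => [|a r] //=; case: ltnP => [xa [<- <-]|ax].
    by exists x, r.
  case F: (row_insert x r) => [s [y'|]] // [<- <-]; exists a, s; split=> //.
  apply: leq_ltn_trans ax _.
  by elim: r s F => //= c r IH s; case: ltnP => [xc [_ <-]|_] //; 
    case G: (row_insert x r) => [s' o] [_ ob]; apply: (IH s'); rewrite G ob.
apply: KnuthTrans (knuth_catl [:: z] IHr) _.
move: zr'; rewrite r'E /= => /andP[zh _].
exact: (@KnuthMove [::] t _ _ (KnuthXZY zh hy)).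
Qed.

Definition reading_word (t : tableau) : seq nat := flatten (rev t).

Lemma reading_word_cons r t : reading_word (r :: t) = reading_word t ++ r.
Proof. by rewrite /reading_word rev_cons -cats1 flatten_cat /= cats0. Qed.

Lemma reading_word_cat t u :
  reading_word (t ++ u) = reading_word u ++ reading_word t.
Proof. by rewrite /reading_word rev_cat flatten_cat. Qed.

Lemma knuth_tab_insert x t : all (sorted leq) t ->
  all (sorted leq) (tab_insert x t) /\
  knuth (rcons (reading_word t) x) (reading_word (tab_insert x t)).
Proof.
elim: t x => [|r t IHt] x /=; first by move=> _; split=> //; apply: KnuthRefl.
case/andP=> sr st; have := knuth_row_insert x sr.
have sr' : sorted leq (row_insert x r).1.
  apply: (path_sorted (x := 0)); apply: row_insert_sorted => //.
  by case: r sr => //= a r ->; rewrite andbT.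
case: (row_insert x r) sr' => [r' [y|]] /= sr' k.
  have [st' kt] := IHt y st; split; first by rewrite sr' st'.
  rewrite !reading_word_cons rcons_cat.
  apply: KnuthTrans (knuth_catl _ k) _.
  by rewrite -cat_rcons; apply: knuth_catr.
by split; [rewrite sr' | rewrite !reading_word_cons rcons_cat; apply: knuth_catl].
Qed.

Lemma knuth_insertion_tableau s : knuth s (reading_word (insertion_tableau s)).
Proof.
suff [] : all (sorted leq) (insertion_tableau s) /\
          knuth s (reading_word (insertion_tableau s)) by [].
elim/last_ind: s => [|s x [IHs ks]]; first by split=> //; apply: KnuthRefl.
rewrite /insertion_tableau foldl_rcons -/(insertion_tableau s).
have [? kx] := knuth_tab_insert x IHs; split=> //.
by apply: KnuthTrans kx; rewrite -!cats1; apply: knuth_catr.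
Qed.

(** Plactic moves exchange the extreme letters of a triple, so restricting a
    word to an interval of values turns them into moves or identities. *)
Lemma knuth_filter_interval lo hi s t : knuth s t ->
  knuth [seq i <- s | lo <= i <= hi] [seq i <- t | lo <= i <= hi].
Proof.
move=> st; elim: st => {s t} [s|s t _|s t u _ IH1 _|u v a b ab].
- exact: KnuthRefl.
- exact: KnuthSym.
- exact: KnuthTrans IH1.
rewrite !filter_cat; apply: knuth_cat2.
case: ab => x y z xy yz /=.
  case xI: (lo <= x <= hi); case zI: (lo <= z <= hi);
    case yI: (lo <= y <= hi); try exact: KnuthRefl; last by lia.
  by have := KnuthMove [::] [::] (KnuthYZX xy yz).
case xI: (lo <= x <= hi); case zI: (lo <= z <= hi);
  case yI: (lo <= y <= hi); try exact: KnuthRefl; last by lia.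
by have := KnuthMove [::] [::] (KnuthXZY xy yz).
Qed.

(** ** The plactic class of 563412 *)

(** The permutations with insertion tableau 12/34/56, found by closing 563412
    under plactic moves. *)
Definition class_563412 : seq (seq nat) :=
  [:: [:: 5; 6; 3; 4; 1; 2]; [:: 5; 3; 6; 4; 1; 2]; [:: 5; 3; 6; 1; 4; 2];
      [:: 5; 3; 1; 6; 4; 2]; [:: 5; 6; 3; 1; 4; 2]].

(** No plactic move leaves the list: this is checked on each triple of adjacent
    letters of its five words. *)
Lemma knuth_class_563412 m s t : knuth s t ->
  (s \in map (map (addn m)) class_563412) =
  (t \in map (map (addn m)) class_563412).
Proof.
elim=> {s t} [//|//|s t u _ -> //|u v a b ab].
apply/idP/idP; rewrite !inE => /or4P[|||/orP[]] /eqP;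
  case: ab => x y z xy yz; case: u => [|u1 [|u2 [|u3 [|u4 u]]]] /=.
all: try by move=> /(congr1 size); rewrite /= size_cat /=; lia.
all: by [case; lia | move=> [*]; subst; first [lia | by rewrite ?eqxx ?orbT]].
Qed.

Lemma subseq_class_563412 s : s \in class_563412 -> subseq [:: 5; 3; 4; 2] s.
Proof. by move: s; apply/allP. Qed.

Lemma mem_reading_word t : reading_word t =i flatten t.
Proof.
by move=> x; apply/flattenP/flattenP=> -[r rt xr]; exists r;
  rewrite // ?mem_rev // -mem_rev.
Qed.

(** Restricted to the six values of the given rows, a word with insertion
    tableau [P] is plactically the reading word of these rows, 563412 up to a
    shift, since the other rows contain none of these values. *)
Lemma subseq_of_insertion_tableau (m : nat) (P : tableau) (s : seq nat) :
  uniq (flatten P) ->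
  infix [:: [:: m + 1; m + 2]; [:: m + 3; m + 4]; [:: m + 5; m + 6]] P ->
  insertion_tableau s = P -> subseq [:: m + 5; m + 3; m + 4; m + 2] s.
Proof.
move=> uP /infixP[above [below PE]] sP.
pose I i := m + 1 <= i <= m + 6.
have := knuth_filter_interval (m + 1) (m + 6) (knuth_insertion_tableau s).
have other t : {subset flatten t <= flatten above ++ flatten below} ->
    filter I (reading_word t) = [::].
  move=> tab; apply/eqP; rewrite -[_ == _]negbK -has_filter.
  apply/hasP=> -[i]; rewrite mem_reading_word => /tab iab Ii.
  move: uP; rewrite PE !flatten_cat uniq_catCA.
  rewrite cat_uniq => /and3P[_ /hasPn/(_ i iab)/negP[]].
  by move: Ii; rewrite /I /= !inE; lia.
rewrite -/(filter I _) sP PE 2!reading_word_cat 2!filter_cat.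
rewrite (other above) => [|i]; last by rewrite mem_cat => ->.
rewrite (other below) => [|i]; last by rewrite mem_cat orbC => ->.
rewrite cats0 cat0s.
have /all_filterP -> : all I (reading_word
    [:: [:: m + 1; m + 2]; [:: m + 3; m + 4]; [:: m + 5; m + 6]]).
  by rewrite /I /=; lia.
move/(knuth_class_563412 m); rewrite [X in _ = X]mem_head => /mapP[c c5 sc].
apply: subseq_trans (filter_subseq I s).
by rewrite /I sc; apply: (map_subseq (addn m)) (subseq_class_563412 c5).
Qed.
(** * Polynomial functions *)

Section PolynomialFunctions.

Local Open Scope ring_scope.
Import GRing.Theory.

Variable K : closedFieldType.

Lemma evalpC N c (x : 'rV[K]_N) : evalp c%:MP x = c.
Proof. exact: mevalC. Qed.

Lemma evalpX N i (x : 'rV[K]_N) : evalp 'X_i x = x 0 i.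
Proof. exact: mevalXU. Qed.

Lemma evalpD N p q (x : 'rV[K]_N) : evalp (p + q) x = evalp p x + evalp q x.
Proof. exact: mevalD. Qed.

Lemma evalpM N p q (x : 'rV[K]_N) : evalp (p * q) x = evalp p x * evalp q x.
Proof. exact: mevalM. Qed.

Lemma mpoly_ring_ind N (P : {mpoly K[N]} -> Prop) :
  (forall c, P c%:MP) -> (forall i, P 'X_i) ->
  (forall p q, P p -> P q -> P (p + q)) ->
  (forall p q, P p -> P q -> P (p * q)) -> forall p, P p.
Proof.
move=> PC PX PD PM; elim/mpolyind=> [|c m p _ _ Pp]; first by rewrite -mpolyC0.
apply: PD => //; rewrite -mul_mpolyC; apply: (PM) => //.
rewrite mpolyXE_id; elim/big_ind: _ => //; first by rewrite -mpolyC1.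
move=> i _; elim: (m i) => [|k IHk]; first by rewrite expr0 -mpolyC1.
by rewrite exprS; apply: PM.
Qed.

Definition polyfun N (h : 'rV[K]_N -> K) :=
  exists p : {mpoly K[N]}, forall x, h x = evalp p x.

Section Closure.

Variable N : nat.
Implicit Types h : 'rV[K]_N -> K.

Lemma polyfun_evalp p : polyfun (@evalp K N p).
Proof. by exists p. Qed.

Lemma polyfun_cst c : polyfun (fun _ : 'rV[K]_N => c).
Proof. by exists c%:MP => x; rewrite evalpC. Qed.

Lemma polyfun_coord i : polyfun (fun x : 'rV[K]_N => x 0 i).
Proof. by exists 'X_i => x; rewrite evalpX. Qed.

Lemma polyfunD h1 h2 : polyfun h1 -> polyfun h2 -> polyfun (fun x => h1 x + h2 x).
Proof. by move=> [p hp] [q hq]; exists (p + q) => x; rewrite evalpD hp hq. Qed.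

Lemma polyfunM h1 h2 : polyfun h1 -> polyfun h2 -> polyfun (fun x => h1 x * h2 x).
Proof. by move=> [p hp] [q hq]; exists (p * q) => x; rewrite evalpM hp hq. Qed.

Lemma polyfun_sum I r (P : pred I) (h : I -> 'rV[K]_N -> K) :
  (forall i, polyfun (h i)) -> polyfun (fun x => \sum_(i <- r | P i) h i x).
Proof.
move=> hh; elim: r => [|i r [p hp]].
  by exists 0%:MP => x; rewrite big_nil evalpC.
have [q hq] := hh i; exists (if P i then q + p else p) => x.
by rewrite big_cons; case: (P i); rewrite ?evalpD hp ?hq.
Qed.

Lemma polyfun_prod I r (P : pred I) (h : I -> 'rV[K]_N -> K) :
  (forall i, polyfun (h i)) -> polyfun (fun x => \prod_(i <- r | P i) h i x).
Proof.
move=> hh; elim: r => [|i r [p hp]].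
  by exists 1%:MP => x; rewrite big_nil evalpC.
have [q hq] := hh i; exists (if P i then q * p else p) => x.
by rewrite big_cons; case: (P i); rewrite ?evalpM hp ?hq.
Qed.

Lemma polyfunX h k : polyfun h -> polyfun (fun x => h x ^+ k).
Proof.
move=> hh; elim: k => [|k IHk]; first exact: polyfun_cst.
by have [p hp] := polyfunM hh IHk; exists p => x; rewrite exprS hp.
Qed.

Lemma polyfun_ext h1 h2 : h1 =1 h2 -> polyfun h1 -> polyfun h2.
Proof. by move=> e [p hp]; exists p => x; rewrite -e hp. Qed.

Lemma polyfun_det n (M : 'rV[K]_N -> 'M[K]_n) :
  (forall i j, polyfun (fun x => M x i j)) -> polyfun (fun x => \det (M x)).
Proof.
move=> hM; apply: polyfun_sum => s; apply: polyfunM; first exact: polyfun_cst.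
by apply: polyfun_prod => i.
Qed.

End Closure.

Lemma polyfun_comp N N' (h : 'rV[K]_N -> K) (phi : 'rV[K]_N' -> 'rV[K]_N) :
  polyfun h -> (forall i, polyfun (fun x => phi x 0 i)) ->
  polyfun (fun x => h (phi x)).
Proof.
move=> [p hp] hphi; apply: polyfun_ext (fun x => esym (hp (phi x))) _.
elim/mpoly_ring_ind: p {hp} => [c|i|p q hp hq|p q hp hq].
- by apply: polyfun_ext (polyfun_cst _ c) => x; rewrite evalpC.
- by apply: polyfun_ext (hphi i) => x; rewrite evalpX.
- by apply: polyfun_ext (polyfunD hp hq) => x; rewrite evalpD.
- by apply: polyfun_ext (polyfunM hp hq) => x; rewrite evalpM.
Qed.

(** Zariski continuity of polynomial maps. *)
Lemma zclosure_map N N' (phi : 'rV[K]_N' -> 'rV[K]_N) (A B : _ -> Prop) x :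
  (forall i, polyfun (fun x => phi x 0 i)) -> (forall x, A x -> B (phi x)) ->
  zclosure A x -> zclosure B (phi x).
Proof.
move=> hphi AB Ax p pB.
have [q hq] := polyfun_comp (polyfun_evalp p) hphi.
by rewrite hq; apply: Ax => y /AB By; rewrite -hq; apply: pB.
Qed.

Lemma zclosure_sub N (A : zset K N) : zsub A (zclosure A).
Proof. by move=> x Ax p; apply. Qed.

Lemma vanishes_zclosure N (A : zset K N) p :
  vanishes_on p A -> vanishes_on p (zclosure A).
Proof. by move=> pA x; apply. Qed.

Lemma zero_set_closed N (p : {mpoly K[N]}) :
  zclosed (fun x => evalp p x = 0).
Proof. by move=> x; apply. Qed.

(** The coordinate ring of an irreducible set is an integral domain. *)
Lemma vanishes_on_mul N (Z : zset K N) p q : zirreducible Z ->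
  vanishes_on (p * q) Z -> vanishes_on p Z \/ vanishes_on q Z.
Proof.
move=> [_ irrZ] pqZ; apply: irrZ; try exact: zero_set_closed.
move=> x /pqZ /eqP; rewrite evalpM mulf_eq0 => /orP[] /eqP; by [left|right].
Qed.

(** ** Restriction to lines *)

Lemma poly_vanishing_eq0 (r : {poly K}) : (forall t, t != 0 -> r.[t] = 0) -> r = 0.
Proof.
(* otherwise 'X * r + 1 is a polynomial without roots *)
move=> r0; apply/eqP/negPn/negP=> rn0.
have : size ('X * r + 1) != 1.
  rewrite size_polyDl mulrC size_mulX // ?size_poly1 ?ltnS ?lt0n
    ?size_poly_eq0 //.
  by rewrite eqSS size_poly_eq0.
move/closed_rootP=> -[t] /rootP; rewrite !hornerE.
have [->|/r0 ->] := eqVneq t 0; rewrite ?mul0r ?mulr0 add0r => /eqP;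
  by rewrite oner_eq0.
Qed.

Lemma evalp_line N (p : {mpoly K[N]}) (x v : 'rV[K]_N) :
  exists2 r : {poly K}, forall t, evalp p (x + t *: v) = r.[t] &
    r^`().[0] = \sum_i evalp p^`M(i) x * v 0 i.
Proof.
elim/mpoly_ring_ind: p => [c|j|p q [r rp r'] [s sq s']|p q [r rp r'] [s sq s']].
- exists c%:P => [t|]; first by rewrite evalpC hornerC.
  rewrite derivC horner0 big1 // => i _.
  by rewrite mderivC -mpolyC0 evalpC mul0r.
- exists ((x 0 j)%:P + v 0 j *: 'X) => [t|].
    by rewrite evalpX !mxE !hornerE mulrC.
  rewrite derivD derivC derivZ derivX !hornerE (bigD1 j) //= big1 => [|i ij].
    rewrite mderivX mnm1E eqxx scale1r.
    have -> : (U_(j) - U_(j) = 0 :> 'X_{1..N})%MM.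
      by apply/mnmP=> i; rewrite !mnmE subnn.
    by rewrite mpolyX0 -mpolyC1 evalpC mul1r addr0.
  by rewrite mderivX mnm1E eq_sym (negPf ij) scale0r -mpolyC0 evalpC mul0r.
- exists (r + s) => [t|]; first by rewrite evalpD rp sq hornerD.
  rewrite derivD hornerD r' s' -big_split; apply: eq_bigr => i _.
  by rewrite mderivD evalpD mulrDl.
- exists (r * s) => [t|]; first by rewrite evalpM rp sq hornerM.
  rewrite derivM hornerD !hornerM r' s'.
  rewrite -rp -sq scale0r addr0 mulr_suml mulr_sumr -big_split.
  by apply: eq_bigr => i _; rewrite mderivM evalpD !evalpM /=; ring.
Qed.

(** A polynomial vanishing at all but one point of a line vanishes on the line. *)
Lemma zclosure_line N (A : zset K N) (x v : 'rV[K]_N) :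
  (forall t, t != 0 -> zclosure A (x + t *: v)) -> zclosure A x.
Proof.
move=> lineA p pA; have [r rE _] := evalp_line p x v.
have -> : x = x + 0 *: v by rewrite scale0r addr0.
rewrite rE (_ : r = 0) ?horner0 //; apply: poly_vanishing_eq0 => t /lineA At.
by rewrite -rE; apply: At.
Qed.

Lemma tangent_line N (A : zset K N) (x v : 'rV[K]_N) :
  (forall t, A (x + t *: v)) -> tangent A x v.
Proof.
move=> lineA p pA; have [r rE <-] := evalp_line p x v.
rewrite (_ : r = 0) ?deriv0 ?horner0 //; apply: poly_vanishing_eq0 => t _.
by rewrite -rE; apply: pA.
Qed.

End PolynomialFunctions.
(** * Algebraic independence and chains of irreducible sets *)

Section Dimension.

Local Open Scope ring_scope.
Import GRing.Theory.

Variable K : closedFieldType.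

Lemma muni_eval m (F : {mpoly K[m.+1]}) (v : 'I_m.+1 -> K) :
  (map_poly (meval (fun i => v (widen_ord (leqnSn m) i))) (muni F)).[v ord_max] =
  F.@[v].
Proof.
rewrite muniE mevalE rmorph_sum horner_sum; apply: eq_bigr => e _ /=.
rewrite -!mul_polyC !rmorphM /= map_polyXn !map_polyC /= hornerM hornerXn hornerC.
rewrite -mul_mpolyC rmorphM /= mevalC mevalX big_ord_recr /= mulrA.
by congr (_ * _ * _); apply: eq_bigr => i _; rewrite mnmE.
Qed.

(** The coefficient of [F] at a multinomial [e] is recovered from [muni F]: it
    sits in degree [e ord_max], at the multinomial [low e] of the other
    exponents. *)
Lemma muni_eq0 m (F : {mpoly K[m.+1]}) : muni F = 0 -> F = 0.
Proof.
move=> F0; apply/mpolyP=> e; rewrite mcoeff0.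
pose low (e : 'X_{1..m.+1}) := [multinom e (widen_ord (leqnSn m) i) | i < m].
have lowI (e1 e2 : 'X_{1..m.+1}) :
    low e1 = low e2 -> e1 ord_max = e2 ord_max -> e1 = e2.
  move=> /mnmP lowE maxE; apply/mnmP=> i.
  have [->//|i_max] := eqVneq i ord_max.
  have im : (i < m)%N.
    by rewrite ltn_neqAle -ltnS ltn_ord andbT; apply: contra i_max => /eqP im;
       apply/eqP/val_inj.
  have := lowE (Ordinal im); rewrite !mnmE.
  by rewrite (_ : widen_ord _ _ = i) //; apply: val_inj.
have := congr1 (fun r : {poly {mpoly K[m]}} => (r`_(e ord_max))@_(low e)) F0.
rewrite muniE coef_sum raddf_sum /= coef0 mcoeff0 => sum0.
have [eF|/memN_msupp_eq0//] := boolP (e \in msupp F).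
rewrite -sum0 (bigD1_seq e) //= big1_seq => [|e' /andP[e'e _]].
  by rewrite coefZ coefXn eqxx mulr1 mcoeffZ mcoeffX eqxx mulr1 addr0.
rewrite coefZ coefXn; case: eqP => [maxE|_]; last by rewrite mulr0 mcoeff0.
rewrite mulr1 mcoeffZ mcoeffX; case: eqP => [lowE|_]; last by rewrite mulr0.
by case/eqP: e'e; apply: lowI.
Qed.

Definition alg_independent_on N m (Z : zset K N) (q : 'I_m -> {mpoly K[N]}) :=
  forall F : {mpoly K[m]},
    (forall x, Z x -> F.@[fun i => evalp (q i) x] = 0) -> F = 0.

Lemma zsubPn N (A B : zset K N) : zclosed B -> ~ zsub A B ->
  exists2 p, vanishes_on p B & ~ vanishes_on p A.
Proof.
move=> Bcl AB; apply: NNPP => np; apply: AB => x Ax; apply: Bcl => p pB.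
by apply: NNPP => px; apply: np; exists p => // /(_ x Ax).
Qed.

(** A function [p] that vanishes on [Y] but not on the larger irreducible [Z] is
    independent of functions that are already independent on [Y]: dividing a
    relation by the largest possible power of [p], and restricting it to [Y],
    gives a relation among the latter. *)
Lemma alg_independent_extend N m (Y Z : zset K N) (q : 'I_m -> {mpoly K[N]}) p :
  zsub Y Z -> zirreducible Z -> vanishes_on p Y -> ~ vanishes_on p Z ->
  alg_independent_on Y q ->
  alg_independent_on Z (fun i => if unlift ord_max i is Some j then q j else p).
Proof.
move=> YZ Zirr pY pZ qY F FZ; apply: muni_eq0.
pose at_ (x : 'rV[K]_N) := meval (fun i => evalp (q i) x).
have {FZ}: forall x, Z x -> (map_poly (at_ x) (muni F)).[evalp p x] = 0.
  move=> x /FZ <-; rewrite -[RHS]muni_eval unlift_none; congr (_.[_]).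
  apply/eq_map_poly=> c; apply: meval_eq => i.
  have -> : widen_ord (leqnSn m) i = lift ord_max i.
    by apply: val_inj; rewrite /= /bump leqNgt ltn_ord.
  by rewrite liftK.
elim/poly_ind: (muni F) => {F} // r c IHr rcZ.
have c0 : c = 0.
  apply: qY => x Yx; have := rcZ x (YZ x Yx).
  by rewrite rmorphD rmorphM /= map_polyX map_polyC !hornerE pY // mulr0 add0r.
rewrite c0 addr0 IHr ?mul0r // => x Zx.
have {}rcZ y : Z y -> (map_poly (at_ y) r).[evalp p y] * evalp p y = 0.
  by move/rcZ; rewrite c0 addr0 rmorphM /= map_polyX hornerMX.
have [g gE] : exists g : {mpoly K[N]},
    forall y, evalp g y = (map_poly (at_ y) r).[evalp p y].
  exists (map_poly (comp_mpoly [tuple q i | i < m]) r).[p] => y.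
  rewrite /evalp -horner_map -map_poly_comp; congr (_.[_]).
  apply/eq_map_poly=> d /=; rewrite comp_mpoly_meval; apply: meval_eq => i.
  by rewrite tnth_mktuple.
rewrite -gE; suff: vanishes_on g Z by apply.
case: (vanishes_on_mul Zirr (p := g) (q := p)) => // y Zy.
by rewrite evalpM gE rcZ.
Qed.

Lemma mpoly0_const (F : {mpoly K[0]}) : exists c, F = c%:MP.
Proof.
elim/mpoly_ring_ind: F => [c|[]//|_ _ [c ->] [d ->]|_ _ [c ->] [d ->]].
- by exists c.
- by exists (c + d); rewrite mpolyCD.
- by exists (c * d); rewrite mpolyCM.
Qed.

(** This takes the place of the comparison of Krull dimension with transcendence
    degree. *)
Lemma chain_alg_independent N (Z : nat -> zset K N) m :
  (forall i, (i <= m)%N -> zclosed (Z i) /\ zirreducible (Z i)) ->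
  (forall i, (i < m)%N -> zsub (Z i) (Z i.+1) /\ ~ zsub (Z i.+1) (Z i)) ->
  exists q : 'I_m -> {mpoly K[N]}, alg_independent_on (Z m) q.
Proof.
elim: m => [|m IHm] Zirr Zlt.
  exists (fun=> 0) => F FZ; have [c cF] := mpoly0_const F.
  have [[x Zx] _] := (Zirr 0%N isT).2.
  by have := FZ x Zx; rewrite cF mevalC => ->.
have [i im|i im|q qZ] := IHm.
- exact/Zirr/leqW.
- exact/Zlt/leqW.
have [ZmS ZmN] := Zlt m (ltnSn m).
have [p pZ pN] := zsubPn (Zirr m (leqnSn m)).1 ZmN.
exists (fun i => if unlift ord_max i is Some j then q j else p).
exact: alg_independent_extend (Zirr m.+1 (leqnn _)).2 pZ pN qZ.
Qed.

(** ** Dependence of rational functions *)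

Lemma msizeM_leq l (p q : {mpoly K[l]}) d e :
  (msize p <= d.+1)%N -> (msize q <= e.+1)%N -> (msize (p * q) <= (d + e).+1)%N.
Proof.
have [->|p0] := eqVneq p 0; first by rewrite mul0r msize0.
have [->|q0] := eqVneq q 0; first by rewrite mulr0 msize0.
rewrite msizeM // => pd qe; have := leq_add pd qe.
by rewrite addSn addnS; case: (_ + _)%N.
Qed.

Lemma msizeX_leq l (p : {mpoly K[l]}) d k :
  (msize p <= d.+1)%N -> (msize (p ^+ k) <= (k * d).+1)%N.
Proof.
move=> pd; elim: k => [|k IHk]; first by rewrite expr0 msize1.
by rewrite exprS mulSn; apply: msizeM_leq.
Qed.

Lemma msize_prod_leq l m (p : 'I_m -> {mpoly K[l]}) d :
  (forall i, msize (p i) <= d.+1)%N -> (msize (\prod_i p i)%R <= (m * d).+1)%N.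
Proof.
elim: m p => [|m IHm] p pd; first by rewrite big_ord0 msize1.
by rewrite big_ord_recl mulSn; apply: msizeM_leq => //; apply: IHm.
Qed.

Lemma card_bmultinom_leq l d : (#|{: 'X_{1..l < d}}| <= d ^ l)%N.
Proof.
case: d => [|d].
  by rewrite (_ : #|_| = 0%N) //; apply: eq_card0 => -[].
pose f (e : 'X_{1..l < d.+1}) := [ffun i : 'I_l => inord (e i) : 'I_d.+1].
have /leq_card : injective f.
  move=> e1 e2 /ffunP e12; apply/eqP; rewrite bmeqP; apply/eqP/mnmP=> i.
  have lt (e : 'X_{1..l < d.+1}) : (e i < d.+1)%N.
    by apply: leq_ltn_trans (bmdeg e); rewrite mdegE (bigD1 i) //= leq_addr.
  by have := congr1 val (e12 i); rewrite !ffunE /= !inordK.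
by rewrite card_ffun !card_ord.
Qed.

(** More than [l] rational functions in [l] variables, here with a common
    denominator, are algebraically dependent: the number of their monomials with
    exponents at most [M] grows faster with [M] than the dimension of the space
    of numerators. *)
Lemma alg_dependent l m (a : 'I_m -> {mpoly K[l]}) (b : {mpoly K[l]}) :
  (l < m)%N ->
  exists2 F : {mpoly K[m]}, F != 0 & forall s : 'rV[K]_l, evalp b s != 0 ->
    F.@[fun i => evalp (a i) s / evalp b s] = 0.
Proof.
move=> lm; pose D := maxn (msize b) (\max_i msize (a i)).
have bD : (msize b <= D.+1)%N by rewrite leqW // leq_maxl.
have aD i : (msize (a i) <= D.+1)%N.
  by rewrite leqW // leq_max orbC (leq_bigmax i).
(* [M] is chosen so that (m M D + 1)^l < (M + 1)^(l + 1) *)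
pose M := ((m * D).+1 ^ l)%N; pose d := (m * (M * D)).+1.
pose A := {ffun 'I_m -> 'I_M.+1}; pose B := 'X_{1..l < d}.
have cardAB : (#|{: B}| < #|{: A}|)%N.
  rewrite card_ffun !card_ord; apply: leq_ltn_trans (card_bmultinom_leq _ _) _.
  apply: (@leq_trans (M.+1 ^ l.+1)); last by rewrite leq_pexp2l.
  have Mpos : (0 < M)%N by rewrite expn_gt0.
  have : (d <= (m * D).+1 * M.+1)%N by rewrite /d; nia.
  rewrite -(@leq_exp2r _ _ l.+1) // => dM.
  case: (posnP l) dM => [->|l0] dM; first by rewrite expn0 expn1.
  apply: (@leq_ltn_trans (M * M.+1 ^ l)).
    by rewrite -expnMn leq_exp2r // /d; nia.
  by rewrite expnS ltn_pmul2r ?expn_gt0.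
(* the monomial [al] in the fractions, cleared of denominators *)
pose G (al : A) := \prod_i (a i ^+ al i * b ^+ (M - al i)).
have Gd al : (msize (G al) <= d)%N.
  apply: msize_prod_leq => i; have := ltn_ord (al i); rewrite ltnS => alM.
  have -> : (M * D = al i * D + (M - al i) * D)%N by rewrite -mulnDl subnKC.
  by apply: msizeM_leq; apply: msizeX_leq.
pose Gm : 'M[K]_(#|{: A}|, #|{: B}|) :=
  \matrix_(i, j) (G (enum_val i))@_(enum_val j : B).
have : kermx Gm != 0.
  rewrite -mxrank_eq0 mxrank_ker -lt0n subn_gt0.
  exact: leq_ltn_trans (rank_leq_col _) cardAB.
case/rowV0Pn=> c /sub_kermxP cG c0.
have cG0 : \sum_al c 0 (enum_rank al) *: G al = 0.
  apply/mpolyP=> e; rewrite mcoeff0 raddf_sum /=.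
  have [ed|ed] := ltnP (mdeg e) d; last first.
    rewrite big1 // => al _; rewrite mcoeffZ memN_msupp_eq0 ?mulr0 //.
    apply: msize_mdeg_ge; exact: leq_trans (Gd al) ed.
  have := congr1 (fun v : 'rV_ _ => v 0 (enum_rank (BMultinom ed))) cG.
  rewrite !mxE => cGe; rewrite -[RHS]cGe [RHS](reindex (@enum_rank A)) /=.
    by apply: eq_bigr => al _; rewrite mcoeffZ mxE !enum_rankK.
  exact/onW_bij/enum_rank_bij.
pose expo (al : A) := [multinom (al i : nat) | i < m].
exists (\sum_al c 0 (enum_rank al) *: 'X_[expo al]) => [|s bs].
  case/matrix0Pn: c0 => i [j]; rewrite ord1 => cj; apply: contraNneq cj => F0.
  have := congr1 (mcoeff (expo (enum_val j))) F0.
  rewrite mcoeff0 raddf_sum /= (bigD1 (enum_val j)) //= big1 => [|al alj].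
    by rewrite mcoeffZ mcoeffX eqxx mulr1 addr0 enum_valK => ->.
  rewrite mcoeffZ mcoeffX; case: eqP => [/mnmP alE|_]; last by rewrite mulr0.
  case/eqP: alj; apply/ffunP=> k; apply: val_inj.
  by have := alE k; rewrite !mnmE.
rewrite raddf_sum /=; have := congr1 (fun p => evalp p s) cG0.
rewrite /evalp raddf_sum meval0 /= => cG0s.
apply: (mulfI (expf_neq0 (m * M) bs)); rewrite mulr0 -[RHS]cG0s mulr_sumr.
apply: eq_bigr => al _; rewrite !mevalZ mulrCA; congr (_ * _).
rewrite mevalX rmorph_prod mulnC exprM -{1}[m]card_ord -prodr_const -big_split.
apply: eq_bigr => i _; rewrite mnmE /= rmorphM !rmorphXn /= -/(evalp b s).
have := ltn_ord (al i); rewrite ltnS => alM.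
have -> : evalp b s ^+ M = evalp b s ^+ al i * evalp b s ^+ (M - al i).
  by rewrite -exprD subnKC.
by rewrite mulrAC -exprMn mulrCA mulfV ?mulr1.
Qed.

(** ** Chains in the closure of a rationally parametrized set *)

(** [h] agrees on the open set [f != 0] with an element of the localization at
    [f] of the ring of polynomial functions. *)
Definition regular_off N (f h : 'rV[K]_N -> K) :=
  exists a e, polyfun a /\ forall x, f x != 0 -> h x = a x / f x ^+ e.

Lemma regular_off_comp N N' (f : 'rV[K]_N' -> K) (phi : 'rV[K]_N' -> 'rV[K]_N) p :
  polyfun f -> (forall i, regular_off f (fun x => phi x 0 i)) ->
  regular_off f (fun x => evalp p (phi x)).
Proof.
move=> pf phif.
elim/mpoly_ring_ind: p => [c|i|p q|p q].
- exists (fun=> c), 0%N; split=> [|x _]; first exact: polyfun_cst.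
  by rewrite evalpC divr1.
- have [a [e [pa phiE]]] := phif i.
  by exists a, e; split=> // x fx; rewrite evalpX phiE.
- move=> [a [e [pa pE]]] [b [d [pb qE]]].
  exists (fun x => a x * f x ^+ d + b x * f x ^+ e), (e + d)%N.
  split=> [|x fx].
    by apply: polyfunD; apply: polyfunM => //; apply: polyfunX.
  by rewrite evalpD pE // qE // exprD; field; rewrite !expf_neq0.
- move=> [a [e [pa pE]]] [b [d [pb qE]]].
  exists (fun x => a x * b x), (e + d)%N; split=> [|x fx].
    exact: polyfunM.
  by rewrite evalpM pE // qE // exprD; field; rewrite !expf_neq0.
Qed.

Lemma regular_off_common_exponent N m (f : 'rV[K]_N -> K)
    (h : 'I_m -> 'rV[K]_N -> K) :
  polyfun f -> (forall i, regular_off f (h i)) ->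
  exists (a : 'I_m -> {mpoly K[N]}) e,
    forall i x, f x != 0 -> h i x = evalp (a i) x / f x ^+ e.
Proof.
move=> pf hf.
have /fin_all_exists[e eP] (i : 'I_m) : exists e, exists p : {mpoly K[N]},
    forall x, f x != 0 -> h i x = evalp p x / f x ^+ e.
  have [a [e [[p ap] hE]]] := hf i; exists e, p => x fx; by rewrite hE // ap.
have /fin_all_exists[a aP] (i : 'I_m) : exists p : {mpoly K[N]},
    forall x, f x != 0 -> h i x = evalp p x / f x ^+ (\max_j e j).
  have [p hE] := eP i.
  have [q qE] := polyfunM (polyfun_evalp p) (polyfunX (\max_j e j - e i) pf).
  exists q => x fx; rewrite -qE hE //.
  have -> : f x ^+ (\max_j e j) = f x ^+ (\max_j e j - e i) * f x ^+ e i.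
    by rewrite -exprD subnK // leq_bigmax.
  by field; rewrite !expf_neq0.
by exists a, (\max_j e j).
Qed.

(** Let a rational map [phi] send the closure of [B] onto [A], and [B] to values
    that it takes on the image of a polynomial map [theta] of [l] variables.
    Then polynomial functions on [A] pull back to rational functions in [l]
    variables, so that no more than [l] of them are independent. *)
Lemma irr_chain_leq N N' l (A : zset K N) (B : zset K N') (f : 'rV[K]_N' -> K)
    (phi : 'rV[K]_N' -> 'rV[K]_N) (theta : 'rV[K]_l -> 'rV[K]_N') y m :
  polyfun f -> (forall i, regular_off f (fun x => phi x 0 i)) ->
  (forall i, polyfun (fun s => theta s 0 i)) ->
  (forall x, B x -> f x != 0 ->
     exists s, f (theta s) != 0 /\ phi (theta s) = phi x) ->
  (forall u, A u -> exists x, [/\ zclosure B x, f x != 0 & phi x = u]) ->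
  irr_chain A y m -> (m <= l)%N.
Proof.
move=> pf phif ptheta Btheta BA [Z [Zirr Zlt _ ZA]]; rewrite leqNgt.
apply/negP=> lm; have [q qZ] := chain_alg_independent Zirr Zlt.
have [a [e qE]] := regular_off_common_exponent pf
  (fun i => regular_off_comp (q i) pf phif).
have /fin_all_exists[a' a'E] i : exists p : {mpoly K[l]},
    forall s, evalp (a i) (theta s) = evalp p s.
  exact: polyfun_comp (polyfun_evalp (a i)) ptheta.
have [b bE] := polyfun_comp (polyfunX e pf) ptheta.
have [F F0 Fdep] := alg_dependent a' b lm.
case/eqP: F0; apply: qZ => u /ZA /BA[x [Bx fx <-]].
pose q' := F \mPo [tuple q i | i < m].
have q'E z : evalp q' z = F.@[fun i => evalp (q i) z].
  by rewrite /evalp comp_mpoly_meval; apply: meval_eq => i; rewrite tnth_mktuple.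
rewrite -q'E; have [h [d [[p hp] q'phiE]]] := regular_off_comp q' pf phif.
have [g gE] := pf.
(* the factor [g], that is [f], removes the points where [phi] is undefined *)
have gpB : vanishes_on (g * p) B.
  move=> z Bz; rewrite evalpM -gE -hp; have [->|fz] := eqVneq (f z) 0.
    by rewrite mul0r.
  have [s [fs phis]] := Btheta z Bz fz.
  have fe : evalp b s != 0 by rewrite -bE expf_neq0.
  have : evalp q' (phi z) = 0.
    rewrite q'E -[RHS](Fdep s fe); apply: meval_eq => i.
    by rewrite -phis qE // a'E bE.
  rewrite q'phiE // => /eqP; rewrite mulf_eq0 invr_eq0 expf_eq0 (negPf fz) andbF.
  by rewrite orbF => /eqP ->; rewrite mulr0.
have /eqP := vanishes_zclosure gpB Bx.
rewrite evalpM -gE -hp mulf_eq0 (negPf fx) /= => /eqP hx.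
by rewrite q'phiE // hx mul0r.
Qed.

End Dimension.
(** * Schubert varieties *)

Section SchubertVarieties.

Local Open Scope ring_scope.
Import GRing.Theory.

Variables (K : closedFieldType) (n : nat).
Implicit Types (w u : 'S_n) (a b c g h : 'M[K]_n).

Lemma upper_det c : (forall i j : 'I_n, (j < i)%N -> c i j = 0) ->
  \det c = \prod_i c i i.
Proof.
move=> c0; rewrite -det_tr det_trig; last first.
  by apply/is_trig_mxP=> i j ij; rewrite mxE c0.
by apply: eq_bigr => i _; rewrite mxE.
Qed.

Lemma upper_borel c : (forall i j : 'I_n, (j < i)%N -> c i j = 0) ->
  (forall i, c i i != 0) -> in_borel c.
Proof.
move=> c0 ci; split=> //; rewrite unitmxE upper_det // unitfE.
by apply/prodf_neq0.
Qed.

Lemma borel_diag c i : in_borel c -> c i i != 0.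
Proof.
case=> cu c0; move: cu; rewrite unitmxE upper_det // unitfE => /prodf_neq0.
exact.
Qed.

Lemma borel1 : in_borel (1%:M : 'M[K]_n).
Proof.
split=> [|i j ji]; first exact: unitmx1.
by rewrite mxE (_ : (i == j) = false) //; apply/eqP=> ij; rewrite ij ltnn in ji.
Qed.

Lemma borelM a b : in_borel a -> in_borel b -> in_borel (a *m b).
Proof.
move=> [au a0] [bu b0]; split=> [|i j ji]; first by rewrite unitmx_mul au.
rewrite mxE big1 // => k _; have [ki|ik] := ltnP k i; first by rewrite a0 ?mul0r.
by rewrite b0 ?mulr0 //; apply: leq_trans ik.
Qed.

Lemma transvectionK (i j : 'I_n) t : i != j ->
  (1%:M + t *: delta_mx i j) *m (1%:M - t *: delta_mx i j) = 1%:M :> 'M[K]_n.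
Proof.
move=> ij; rewrite mulmxDl !mulmxBr !mulmx1 !mul1mx -scalemxAl -scalemxAr.
by rewrite mul_delta_mx_0 1?eq_sym // !scaler0 subr0 subrK.
Qed.

Lemma transvection_unit (i j : 'I_n) t : i != j ->
  (1%:M + t *: delta_mx i j : 'M[K]_n) \in unitmx.
Proof. by move=> ij; have [] := mulmx1_unit (transvectionK t ij). Qed.

Lemma transvection_borel (i j : 'I_n) t : (i < j)%N ->
  in_borel (1%:M + t *: delta_mx i j : 'M[K]_n).
Proof.
move=> ij; split=> [|k l lk].
  by apply: transvection_unit; apply: contraTneq ij => ->; rewrite ltnn.
rewrite !mxE; have /negPf -> : k != l by apply: contraTneq lk => ->; rewrite ltnn.
case: eqP => [ki|_]; last by rewrite mulr0 addr0.
case: eqP => [lj|_]; last by rewrite mulr0 addr0.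
by move: lk; rewrite ki lj => /(ltn_trans ij); rewrite ltnn.
Qed.

Lemma perm_matrix_mulE w g i j : (g *m perm_matrix K w) i j = g i (w j).
Proof.
rewrite mxE (bigD1 (w j)) //= mxE eqxx mulr1 big1 ?addr0 // => k /negPf kw.
by rewrite mxE kw mulr0.
Qed.

Lemma mul_perm_matrixE w g i j : (perm_matrix K w *m g) (w i) j = g i j.
Proof.
rewrite mxE (bigD1 i) //= mxE eqxx mul1r big1 ?addr0 // => k ki.
by rewrite mxE eq_sym (inj_eq perm_inj) (negPf ki) mul0r.
Qed.

Lemma perm_matrixM (s t : 'S_n) :
  perm_matrix K (s * t)%g = perm_matrix K t *m perm_matrix K s.
Proof. by apply/matrixP=> i j; rewrite perm_matrix_mulE !mxE permM. Qed.

Lemma perm_matrix1 : perm_matrix K (1%g : 'S_n) = 1%:M.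
Proof. by apply/matrixP=> i j; rewrite !mxE perm1. Qed.

Lemma perm_matrix_unit w : perm_matrix K w \in unitmx.
Proof.
apply: (proj1 (mulmx1_unit (B := perm_matrix K w^-1) _)).
by rewrite -perm_matrixM mulVg perm_matrix1.
Qed.

Lemma perm_matrix_delta w i j :
  perm_matrix K w *m delta_mx i j = delta_mx (w i) (w j) *m perm_matrix K w.
Proof.
apply/matrixP=> k l; rewrite perm_matrix_mulE -(permKV w k) mul_perm_matrixE.
by rewrite !mxE !(inj_eq perm_inj).
Qed.

Lemma perm_matrix_transvection w i j t :
  perm_matrix K w *m (1%:M + t *: delta_mx i j) =
  (1%:M + t *: delta_mx (w i) (w j)) *m perm_matrix K w.
Proof.
by rewrite mulmxDr mulmxDl mulmx1 mul1mx -scalemxAr -scalemxAl perm_matrix_delta.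
Qed.

(** ** Points in the closure of a Bruhat cell *)

Definition cell_closure w g : Prop :=
  zclosure (fun x => bruhat_cell w (vec_mx x)) (mxvec g).

Lemma polyfun_matrix N (M : 'rV[K]_N -> 'M[K]_n) k :
  (forall i j, polyfun (fun x => M x i j)) -> polyfun (fun x => mxvec (M x) 0 k).
Proof.
move=> pM; case/mxvec_indexP: k => i j.
by apply: polyfun_ext (pM i j) => x; rewrite mxvecE.
Qed.

Lemma polyfun_mulmx N (A M : 'rV[K]_N -> 'M[K]_n) i j :
  (forall i j, polyfun (fun x => A x i j)) ->
  (forall i j, polyfun (fun x => M x i j)) ->
  polyfun (fun x => (A x *m M x) i j).
Proof.
move=> pA pM; have p : polyfun (fun x => \sum_k A x i k * M x k j).
  by apply: polyfun_sum => k; apply: polyfunM.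
by apply: polyfun_ext p => x; rewrite mxE.
Qed.

Lemma polyfun_vec_mx i j : polyfun (fun x : 'rV[K]_(n * n) => vec_mx x i j).
Proof.
by apply: polyfun_ext (polyfun_coord K (mxvec_index i j)) => x; rewrite mxE.
Qed.

Lemma cell_closure_borel w b c g : in_borel b -> in_borel c ->
  cell_closure w g -> cell_closure w (b *m g *m c).
Proof.
move=> Bb Bc; rewrite /cell_closure -{2}[g]mxvecK.
apply: (zclosure_map (phi := fun x => mxvec (b *m vec_mx x *m c))) => [k|x].
  apply: polyfun_matrix => i j; apply: polyfun_mulmx => i' j'.
    apply: polyfun_mulmx => ? ?; by [apply: polyfun_cst|apply: polyfun_vec_mx].
  exact: polyfun_cst.
case=> b' [c' [Bb' Bc' ->]]; rewrite mxvecK.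
by exists (b *m b'), (c' *m c); split; rewrite ?mulmxA //; apply: borelM.
Qed.

Lemma cell_closure_perm w : cell_closure w (perm_matrix K w).
Proof.
apply: zclosure_sub; rewrite mxvecK; exists 1%:M, 1%:M.
by split; rewrite ?mul1mx ?mulmx1 //; apply: borel1.
Qed.

Lemma cell_closure_line w g h :
  (forall t, t != 0 -> cell_closure w (g + t *: h)) -> cell_closure w g.
Proof.
move=> gh; apply: (zclosure_line (v := mxvec h)) => t /gh.
by rewrite /cell_closure linearD linearZ.
Qed.

(** In the copy of SL_2 attached to the positions [i < j], the nontrivial Bruhat
    cell consists of the matrices with a nonzero lower left entry, and the
    identity lies in its closure. *)
Lemma cell_closure_transvection w u (i j : 'I_n) t : (i < j)%N -> (u i < u j)%N ->
  cell_closure w (perm_matrix K (tperm i j * u)%g) ->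
  cell_closure w (perm_matrix K u *m (1%:M + t *: delta_mx j i)).
Proof.
move=> ij uij Zu.
have nij : i != j by apply: contraTneq ij => ->; rewrite ltnn.
have [nji jNi] : j != i /\ (i == j) = false by rewrite eq_sym (negPf nij).
have Zt : forall t, t != 0 ->
    cell_closure w (perm_matrix K u *m (1%:M + t *: delta_mx j i)).
  move=> {}t t0; pose T := perm_matrix K (tperm i j).
  pose c := T *m ((1%:M - t^-1 *: delta_mx i j) *m (1%:M + t *: delta_mx j i)).
  have TT : T *m T = 1%:M by rewrite -perm_matrixM tperm2 perm_matrix1.
  have -> : perm_matrix K u *m (1%:M + t *: delta_mx j i) =
      (1%:M + t^-1 *: delta_mx (u i) (u j)) *m
      perm_matrix K (tperm i j * u)%g *m c.
    rewrite perm_matrixM -/T (mulmxA _ (perm_matrix K u)).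
    rewrite -perm_matrix_transvection /c -!mulmxA (mulmxA T T) TT mul1mx.
    by rewrite (mulmxA (1%:M + t^-1 *: _)) transvectionK // mul1mx.
  apply: cell_closure_borel => //; first exact: transvection_borel.
  split=> [|k l lk].
    rewrite !unitmx_mul perm_matrix_unit -scaleNr.
    by rewrite !transvection_unit.
  rewrite -[k](tpermK i j) mul_perm_matrixE.
  rewrite mulmxDr mulmx1 -scalemxAr mulmxBl mul1mx -scalemxAl mul_delta_mx.
  rewrite scalerBr scalerA mulfV // scale1r.
  rewrite !mxE; case: tpermP => [ki|kj|/eqP/negPf ki /eqP/negPf kj].
  - have /negPf li : l != i.
      by rewrite -ki; apply: contraTneq lk => ->; rewrite ltnn.
    have /negPf lj : l != j.
      by apply: contraTneq lk => ->; rewrite ki -leqNgt ltnW.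
    by rewrite eq_sym li lj !andbF !mulr0 !subr0 addr0.
  - have /negPf lj : l != j.
      by rewrite -kj; apply: contraTneq lk => ->; rewrite ltnn.
    by rewrite eq_sym lj jNi eqxx andbF !mulr0 subr0 add0r subrr.
  - have /negPf -> : k != l by apply: contraTneq lk => ->; rewrite ltnn.
    by rewrite ki kj !mulr0 !subr0 addr0.
have [->|/Zt//] := eqVneq t 0; rewrite scale0r addr0 mulmx1.
apply: (cell_closure_line (h := perm_matrix K u *m delta_mx j i)) => s /Zt.
by rewrite mulmxDr mulmx1 -scalemxAr.
Qed.

Lemma cell_closure_down w u (i j : 'I_n) : (i < j)%N -> (u j < u i)%N ->
  cell_closure w (perm_matrix K u) ->
  cell_closure w (perm_matrix K (tperm i j * u)%g).
Proof.
move=> ij uji Zu; rewrite -[perm_matrix K _]mulmx1.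
have -> : 1%:M = 1%:M + 0 *: delta_mx j i :> 'M[K]_n by rewrite scale0r addr0.
apply: cell_closure_transvection => //; first by rewrite !permM tpermL tpermR.
by rewrite mulgA tperm2 mul1g.
Qed.

(** ** Flag minors *)

(** The minor of [h] on the rows [0, ..., j - 1, i] and the columns [0, ..., j],
    as the determinant of a square matrix of size [n] that is the identity on
    the other columns. *)
Definition flag_minor h (i j : 'I_n) : K :=
  \det (\matrix_(a, k) if (k <= j)%N
                       then if (a < j)%N then h a k else if a == j then h i k else 0
                       else (a == k)%:R).

Lemma flag_minor_borel h c i j : in_borel c ->
  flag_minor (h *m c) i j =
  flag_minor h i j * \prod_(k < n) (if (k <= j)%N then c k k else 1).
Proof.
move=> [_ c0].
pose c' : 'M[K]_n := \matrix_(a, k) if (k <= j)%N then c a k else (a == k)%:R.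
have c'0 (a k : 'I_n) : (k < a)%N -> c' a k = 0.
  move=> ka; rewrite mxE c0 // (_ : a == k = false) ?if_same //.
  by apply: contraTF ka => /eqP->; rewrite ltnn.
have -> : \prod_(k < n) (if (k <= j)%N then c k k else 1) = \det c'.
  by rewrite upper_det //; apply: eq_bigr => k _; rewrite mxE eqxx.
rewrite -det_mulmx; congr (\det _); apply/matrixP=> a k; rewrite !mxE.
have [kj|jk] := leqP k j; last first.
  rewrite (bigD1 k) //= !mxE eqxx leqNgt jk /= mulr1 big1 ?addr0 // => l lk.
  by rewrite !mxE (leqNgt k) jk /= (negPf lk) mulr0.
rewrite [RHS](eq_bigr (fun l => (if (a < j)%N then h a l else
    if a == j then h i l else 0) * c l k)) => [|l _]; last first.
  rewrite !mxE kj; have [lj//|jl] := leqP l j.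
  by rewrite (c0 l k) ?mulr0 //; apply: leq_ltn_trans jl.
case: ifP => // _; case: ifP => // _.
by rewrite big1 // => l _; rewrite mul0r.
Qed.

Lemma flag_minor_unipotent h i j : in_opp_unipotent h -> flag_minor h i j = h i j.
Proof.
move=> hU; rewrite /flag_minor det_trig; last first.
  apply/is_trig_mxP=> a k ak; rewrite mxE.
  have /negPf aNk : a != k by apply: contraTneq ak => ->; rewrite ltnn.
  rewrite hU ?(ltnW ak) // aNk; case: ifP => // kj.
  by rewrite (leq_trans ak kj).
rewrite (bigD1 j) //= mxE leqnn ltnn eqxx big1 ?mulr1 // => a aj.
by rewrite mxE eqxx hU // eqxx ltn_neqAle (inj_eq val_inj) aj /=; case: (a <= j)%N.
Qed.

Lemma polyfun_flag_minor N (h : 'rV[K]_N -> 'M[K]_n) i j :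
  (forall k l, polyfun (fun x => h x k l)) ->
  polyfun (fun x => flag_minor (h x) i j).
Proof.
move=> ph; apply: polyfun_det => k l.
have p : polyfun (fun x => if (l <= j)%N then
    if (k < j)%N then h x k l else if k == j then h x i l else 0 else (k == l)%:R).
  by case: (l <= j)%N; first case: (k < j)%N; try case: (k == j);
    (exact: ph || exact: polyfun_cst).
by apply: polyfun_ext p => x; rewrite mxE.
Qed.

(** ** The dimension of a Schubert variety *)

Definition inversions w : {set 'I_n * 'I_n} :=
  [set ij : 'I_n * 'I_n | (ij.1 < ij.2)%N && (w ij.2 < w ij.1)%N].

(** The column-reduced representatives of the cosets [x B] in the Bruhat cell,
    with one free entry for each inversion of [w]. *)
Definition reduced_form w (s : 'rV[K]_(#|inversions w|)) : 'M[K]_n :=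
  perm_matrix K w +
  \sum_k s 0 k *: delta_mx (w (enum_val k).2) (enum_val k).1.

(** In column [j], [c] has to clear the rows [i <= w j] whose pivot is to the left
    of [j]. It combines the columns of these pivots and the column [j], for which
    the coefficients solve a linear system with triangular matrix, a submatrix of
    [b]. *)
Lemma column_reduction w b : in_borel b ->
  exists c s, in_borel c /\ b *m perm_matrix K w *m c = @reduced_form w s.
Proof.
move=> Bb; have [_ b0] := Bb.
pose S (j : 'I_n) := [pred i : 'I_n | (i <= w j)%N && ((w^-1)%g i <= j)%N].
(* this submatrix, completed by the identity to a matrix of size [n] *)
pose A j : 'M[K]_n :=
  \matrix_(i, k) if (i \in S j) && (k \in S j) then b i k else (i == k)%:R.
have A0 j (i k : 'I_n) : (k < i)%N -> A j i k = 0.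
  move=> ki; rewrite mxE; case: ifP => _; first exact: b0.
  by rewrite (_ : i == k = false) //; apply: contraTF ki => /eqP->; rewrite ltnn.
have Aii j i : A j i i != 0.
  by rewrite mxE; case: ifP => _; rewrite ?borel_diag // eqxx oner_eq0.
pose x j : 'cV[K]_n := invmx (A j) *m delta_mx (w j) 0.
have Ax j i : \sum_k A j i k * x j k 0 = (i == w j)%:R.
  have := congr1 (fun v : 'cV[K]_n => v i 0)
    (mulKVmx (upper_borel (A0 j) (Aii j)).1 (delta_mx (w j) 0 : 'cV_n)).
  by rewrite !mxE eqxx andbT => ->.
have wS j : w j \in S j by rewrite inE permK !leqnn.
have xS j i : i \notin S j -> x j i 0 = 0.
  move=> iS; have := Ax j i; rewrite (bigD1 i) //= big1 => [|k ki].
    rewrite mxE (negPf iS) eqxx mul1r addr0 => ->.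
    by case: eqP iS => // ->; rewrite wS.
  by rewrite mxE (negPf iS) eq_sym (negPf ki) mul0r.
have xw j : x j (w j) 0 != 0.
  have := Ax j (w j); rewrite (bigD1 (w j)) //= big1 => [|k kw].
    rewrite eqxx addr0 => /eqP; apply: contraTneq => ->.
    by rewrite mulr0 eq_sym oner_eq0.
  have [/A0->|wk] := ltnP k (w j); first by rewrite mul0r.
  rewrite xS ?mulr0 // inE negb_and -ltnNge ltn_neqAle wk andbT.
  by rewrite (inj_eq val_inj) eq_sym kw.
pose c : 'M[K]_n := \matrix_(k, j) x j (w k) 0.
pose h := b *m perm_matrix K w *m c.
have hE i j : h i j = \sum_k b i k * x j k 0.
  rewrite mxE [RHS](reindex_inj (@perm_inj _ w)); apply: eq_bigr => k _.
  by rewrite perm_matrix_mulE mxE.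
have hS i j : i \in S j -> h i j = (i == w j)%:R.
  move=> iS; rewrite hE -Ax; apply: eq_bigr => k _; rewrite [A j i k]mxE iS /=.
  by have [//|/xS->] := boolP (k \in S j); rewrite !mulr0.
have hNS (i j : 'I_n) : (w j < i)%N -> h i j = 0.
  move=> wi; rewrite hE big1 // => k _; have [ki|ik] := ltnP k i.
    by rewrite b0 ?mul0r.
  by rewrite xS ?mulr0 // inE negb_and -ltnNge (leq_trans wi ik).
exists c, (\row_k h (w (enum_val k).2) (enum_val k).1); split.
  apply: upper_borel => [i j ji|i]; rewrite mxE ?xw //.
  by rewrite xS // inE permK negb_and orbC -ltnNge ji.
apply/matrixP=> i j; rewrite -/h [RHS]mxE summxE [perm_matrix K w i j]mxE.
transitivity ((i == w j)%:R + \sum_(p in inversions w)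
    h (w p.2) p.1 * ((i == w p.2) && (j == p.1))%:R); last first.
  congr (_ + _); rewrite big_enum_val; apply: eq_bigr => k _.
  by rewrite !mxE.
have [iS|iS] := boolP (i \in S j).
  rewrite hS // big1 ?addr0 // => -[k l]; rewrite inE /= => /andP[kl wkl].
  case: andP => [[/eqP iE /eqP jE]|]; last by rewrite mulr0.
  by move: iS; rewrite inE iE permK jE => /andP[_]; rewrite leqNgt kl.
have /negPf iNw : i != w j by apply: contraNneq iS => ->.
rewrite iNw add0r.
have [wi|iw] := ltnP (w j) i.
  rewrite hNS // big1 // => -[k l]; rewrite inE /= => /andP[kl wkl].
  case: andP => [[/eqP iE /eqP jE]|]; last by rewrite mulr0.
  by move: wi; rewrite iE jE ltnNge ltnW.
rewrite (bigD1 (j, (w^-1)%g i)) /=.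
  rewrite permKV !eqxx mulr1 big1 ?addr0 // => -[k l] /andP[_ kl] /=.
  case: andP => [[/eqP iE /eqP jE]|]; last by rewrite mulr0.
  by case/eqP: kl; rewrite iE permK jE.
move: iS; rewrite !inE iw /= permKV -ltnNge => -> /=.
by rewrite ltn_neqAle iw andbT (inj_eq val_inj) iNw.
Qed.

(** The coordinates on a chart are ratios of flag minors, which depend only on
    the coset modulo the Borel subgroup; so on the Bruhat cell they are rational
    functions of the free entries of the reduced representatives. *)
Lemma schubert_chart_dim w g y m : g \in unitmx ->
  irr_chain (schubert_chart w g) y m -> (m <= #|inversions w|)%N.
Proof.
move=> gu; pose minor i j (x : 'rV[K]_(n * n)) :=
  flag_minor (invmx g *m vec_mx x) i j.
have pminor i j : polyfun (minor i j).
  apply: polyfun_flag_minor => k l; apply: polyfun_mulmx => *.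
    exact: polyfun_cst.
  exact: polyfun_vec_mx.
have minor_borel c : in_borel c -> exists2 d : 'I_n -> K, forall j, d j != 0 &
    forall i j h, minor i j (mxvec (h *m c)) = minor i j (mxvec h) * d j.
  move=> Bc; exists (fun j => \prod_(k < n) if (k <= j)%N then c k k else 1) =>
      [j|i j h].
    by apply/prodf_neq0=> k _; case: ifP; rewrite ?borel_diag ?oner_eq0.
  by rewrite /minor !mxvecK mulmxA flag_minor_borel.
pose f x := \prod_j minor j j x.
pose phi x := mxvec (\matrix_(i, j) (minor i j x / minor j j x)).
have borel_phi h c : in_borel c ->
    (f (mxvec (h *m c)) != 0) = (f (mxvec h) != 0) /\
    phi (mxvec (h *m c)) = phi (mxvec h).
  case/minor_borel=> d d0 dE; split.
    rewrite /f (eq_bigr _ (fun j _ => dE j j h)) big_split mulf_eq0 negb_or /=.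
    by rewrite [X in _ && X](_ : _ = true) ?andbT //; apply/prodf_neq0.
  congr mxvec; apply/matrixP=> i j; rewrite !mxE !dE -mulf_div.
  by rewrite divff // mulr1.
apply: (@irr_chain_leq _ _ _ _ _ (fun x => bruhat_cell w (vec_mx x)) f phi
  (fun s => mxvec (reduced_form s))).
- exact: polyfun_prod.
- move=> k; case/mxvec_indexP: k => i j.
  exists (fun x => minor i j x * \prod_(k | k != j) minor k k x), 1%N.
  split=> [|x fx]; first by apply: polyfunM => //; apply: polyfun_prod.
  have -> : f x = minor j j x * \prod_(k | k != j) minor k k x.
    by rewrite /f (bigD1 j).
  rewrite mxvecE mxE expr1 -mulf_div divff ?mulr1 //.
  by move: fx; rewrite /f (bigD1 j) //= mulf_eq0 negb_or => /andP[].
- move=> k; apply: polyfun_matrix => i j.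
  have p : polyfun (fun s : 'rV[K]_(#|inversions w|) => perm_matrix K w i j +
      \sum_k s 0 k * delta_mx (w (enum_val k).2) (enum_val k).1 i j).
    apply: polyfunD; first exact: polyfun_cst.
    apply: polyfun_sum => l; apply: polyfunM; last exact: polyfun_cst.
    exact: polyfun_coord.
  apply: polyfun_ext p => s; rewrite [RHS]mxE summxE; congr (_ + _).
  by apply: eq_bigr => l _; rewrite [RHS]mxE.
- move=> x [b [c [Bb Bc xE]]] fx; have [c' [s [Bc' sE]]] := column_reduction w Bb.
  have {}xE : x = mxvec (b *m perm_matrix K w *m c) by rewrite -xE vec_mxK.
  exists s; move: fx; rewrite -sE xE => fx.
  have [-> ->] := borel_phi (b *m perm_matrix K w) c' Bc'.
  by have [<- ->] := borel_phi (b *m perm_matrix K w) c Bc.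
- move=> u [uU [_ Zu]]; exists (mxvec (g *m vec_mx u)).
  have minorE i j : minor i j (mxvec (g *m vec_mx u)) = vec_mx u i j.
    by rewrite /minor mxvecK mulKmx // flag_minor_unipotent.
  split=> //.
    by apply/prodf_neq0=> j _; rewrite minorE uU // eqxx oner_eq0.
  rewrite -[RHS]vec_mxK; congr mxvec; apply/matrixP=> i j.
  by rewrite mxE !minorE (uU j j) // eqxx divr1.
Qed.

(** ** Tangent spaces and the singularity criterion *)

Lemma leq_tangent_dim (A : zset K (n * n)) x (T : {set 'I_n * 'I_n}) d :
  (forall ij, ij \in T -> tangent A x (mxvec (delta_mx ij.2 ij.1))) ->
  has_tangent_dim A x d -> (#|T| <= d)%N.
Proof.
move=> AT [V [_ VE]].
pose M : 'M[K]_(#|T|, n * n) :=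
  \matrix_k mxvec (delta_mx (enum_val k).2 (enum_val k).1).
have MV : (M <= V)%MS.
  by apply/row_subP=> k; rewrite rowK; apply/VE/AT/enum_valP.
have /eqP <- : row_free M; last exact: leq_trans (mxrankS MV) (rank_leq_row V).
apply/row_freeP; exists M^T; apply/matrixP=> k l; rewrite !mxE.
rewrite (bigD1 (mxvec_index (enum_val k).2 (enum_val k).1)) //= big1.
  rewrite !mxE !mxvecE !mxE !eqxx mul1r addr0; congr (nat_of_bool _)%:R.
  apply/andP/eqP=> [[/eqP e2 /eqP e1]|->] //.
  by apply: enum_val_inj; rewrite [LHS]surjective_pairing
    [RHS]surjective_pairing e1 e2.
move=> q; case/mxvec_indexP: q => i j ij; rewrite !mxE !mxvecE !mxE.
case: andP => [[/eqP ie /eqP je]|]; last by rewrite mul0r.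
by case/eqP: ij; rewrite ie je.
Qed.

Lemma schubert_chart_tangent w u (i j : 'I_n) : (i < j)%N ->
  (forall t, cell_closure w (perm_matrix K u *m (1%:M + t *: delta_mx j i))) ->
  tangent (schubert_chart w (perm_matrix K u)) (mxvec 1%:M) (mxvec (delta_mx j i)).
Proof.
move=> ij Zt; apply: tangent_line => t; rewrite -linearZ -linearD /=.
split; rewrite mxvecK.
  move=> k l kl; rewrite !mxE; case: andP => [[/eqP kj /eqP li]|_]; last first.
    by rewrite mulr0 addr0.
  by move: kl; rewrite kj li leqNgt ij.
split; last exact: Zt.
rewrite unitmx_mul perm_matrix_unit transvection_unit //.
by apply: contraTneq ij => ->; rewrite ltnn.
Qed.

(** At the fixed point [u] of the torus, the transvections [(i, j)] in [T] are
    curves in the Schubert variety of [w]; it is singular at [u] if they are more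
    numerous than its dimension. *)
Lemma not_smooth_of_curves w u (T : {set 'I_n * 'I_n}) :
  cell_closure w (perm_matrix K u) -> (#|inversions w| < #|T|)%N ->
  (forall ij, ij \in T -> (ij.1 < ij.2)%N /\ forall t,
     cell_closure w (perm_matrix K u *m (1%:M + t *: delta_mx ij.2 ij.1))) ->
  ~ smooth K w.
Proof.
move=> Zu ltT curves smooth_w.
have [d [[chain _] dimT]] := smooth_w _ (conj (perm_matrix_unit u) Zu).
have := schubert_chart_dim (perm_matrix_unit u) chain; rewrite leqNgt => /negP[].
apply: leq_trans ltT (leq_tangent_dim _ dimT) => ij /curves[ltij Zij].
exact: schubert_chart_tangent.
Qed.

(** For the pattern 4231 in consecutive values, a singular point of the Schubert
    variety is obtained by replacing the pattern by 2143. All six transvections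
    of the four positions are tangent there, including the position pair of the
    noninversion of 4231, while every other pair of positions is an inversion of
    both permutations or of neither, as the values are consecutive. *)
Lemma consecutive_4231_not_smooth w (i1 i2 i3 i4 : 'I_n) p :
  (i1 < i2)%N -> (i2 < i3)%N -> (i3 < i4)%N ->
  w i1 = (p + 3)%N :> nat -> w i2 = (p + 1)%N :> nat ->
  w i3 = (p + 2)%N :> nat -> w i4 = p :> nat -> ~ smooth K w.
Proof.
move=> lt12 lt23 lt34 w1 w2 w3 w4.
have [lt13 lt24] := (ltn_trans lt12 lt23, ltn_trans lt23 lt34).
have lt14 := ltn_trans lt13 lt34.
have neq (i j : 'I_n) : (i < j)%N -> (i != j) * (j != i).
  by move=> ij; rewrite eq_sym; split; apply: contraTneq ij => ->; rewrite ltnn.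
have [n12 n21] := neq _ _ lt12; have [n13 n31] := neq _ _ lt13.
have [n14 n41] := neq _ _ lt14; have [n23 n32] := neq _ _ lt23.
have [n24 n42] := neq _ _ lt24; have [n34 n43] := neq _ _ lt34.
have tfix := (tpermD n13 n23, tpermD n14 n24, tpermD n12 n32, tpermD n14 n34,
  tpermD n12 n42, tpermD n13 n43, tpermD n21 n31, tpermD n24 n34,
  tpermD n21 n41, tpermD n23 n43, tpermD n31 n41, tpermD n32 n42).
pose v := (tperm i2 i3 * (tperm i3 i4 * (tperm i1 i2 * w)))%g.
pose block : {set 'I_n} := [set i1; i2; i3; i4].
have tE := (permM, tpermL, tpermR, tfix).
have v1 : v i1 = (p + 1)%N :> nat by rewrite !tE.
have v2 : v i2 = p :> nat by rewrite !tE.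
have v3 : v i3 = (p + 3)%N :> nat by rewrite !tE.
have v4 : v i4 = (p + 2)%N :> nat by rewrite !tE.
have out_block i : i \notin block ->
    v i = w i /\ forall j, j \in block -> (w i != w j :> nat).
  move=> iB; split; last first.
    by move=> j jB; rewrite !(inj_eq val_inj) (inj_eq perm_inj);
      apply: contraNneq iB => ->.
  move: iB; rewrite !inE !negb_or -!andbA => /and4P[ni1 ni2 ni3 ni4].
  by rewrite !permM !tpermD // eq_sym.
have in_block i : i \in block ->
    (p <= w i <= p + 3)%N /\ (p <= v i <= p + 3)%N.
  by rewrite !inE -!orbA => /or4P[] /eqP->; rewrite ?v1 ?v2 ?v3 ?v4 ?w1 ?w2 ?w3 ?w4;
    rewrite ?leqnn ?leq_addr ?leq_add2l.
have {}out_block i : i \notin block -> v i = w i /\ ((w i < p) || (p + 3 < w i))%N.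
  move=> /out_block[-> ne]; split=> //.
  have := (ne i1, ne i2, ne i3, ne i4); rewrite !inE !eqxx ?orbT w1 w2 w3 w4.
  move=> [[[/(_ isT) a1 /(_ isT) a2] /(_ isT) a3] /(_ isT) a4].
  by clear -a1 a2 a3 a4; lia.
pose Z u := cell_closure w (perm_matrix K u).
have down (u : 'S_n) (i j : 'I_n) : (i < j)%N -> (u j < u i)%N ->
    Z u -> Z (tperm i j * u)%g.
  exact: cell_closure_down.
have w4' : w i4 = (p + 0)%N :> nat by rewrite addn0.
have wE := (tE, w1, w2, w3, w4', ltn_add2l).
(* each name displays the pattern in the four positions *)
have Z4231 : Z w by apply: cell_closure_perm.
have Z2431 : Z (tperm i1 i2 * w)%g by apply: down; rewrite // !wE.
have Z4213 : Z (tperm i3 i4 * w)%g by apply: down; rewrite // !wE.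
have Z3241 : Z (tperm i1 i3 * w)%g by apply: down; rewrite // !wE.
have Z2413 : Z (tperm i3 i4 * (tperm i1 i2 * w))%g by apply: down; rewrite // !wE.
have Z2341 : Z (tperm i2 i3 * (tperm i1 i2 * w))%g by apply: down; rewrite // !wE.
have Z4123 : Z (tperm i2 i3 * (tperm i3 i4 * w))%g by apply: down; rewrite // !wE.
have Z3142 : Z (tperm i2 i4 * (tperm i1 i3 * w))%g by apply: down; rewrite // !wE.
have Zv : Z v by apply: down; rewrite // !wE.
have perm_ext (s t : 'S_n) : s i1 = t i1 -> s i2 = t i2 -> s i3 = t i3 ->
    s i4 = t i4 -> (forall i, i \notin block -> s i = t i) -> Z s -> Z t.
  move=> e1 e2 e3 e4 e; suff -> : s = t by [].
  apply/permP=> i; have [|/e//] := boolP (i \in block).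
  by rewrite !inE -!orbA => /or4P[] /eqP->.
have tout i : i \notin block ->
    forall k l, k \in block -> l \in block -> tperm k l i = i.
  by move=> iB k l kB lB; rewrite tpermD //; apply: contraNneq iB => <-.
have b1 : i1 \in block by rewrite !inE eqxx.
have b2 : i2 \in block by rewrite !inE eqxx ?orbT.
have b3 : i3 \in block by rewrite !inE eqxx ?orbT.
have b4 : i4 \in block by rewrite !inE eqxx ?orbT.
pose T := [set ij : 'I_n * 'I_n | (ij.1 < ij.2)%N &&
  ((v ij.2 < v ij.1)%N || (ij.1 \in block) && (ij.2 \in block))].
have TE i j : ((i, j) \in T) =
    (i < j)%N && ((v j < v i)%N || (i \in block) && (j \in block)).
  by rewrite in_set.
apply: (not_smooth_of_curves (u := v) (T := T) Zv) => [|[i j]].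
  apply/proper_card/properP; split.
    apply/subsetP=> -[i j]; rewrite [_ \in inversions w]in_set => /andP[/= lij wji].
    rewrite TE lij /=; have [iB|/out_block[-> wi]] := boolP (i \in block).
      have [_|/out_block[-> wj]] := boolP (j \in block); first by rewrite orbT.
      by have := in_block i iB; clear -wji wj; lia.
    have [/in_block|/out_block[-> _]] := boolP (j \in block).
      by clear -wji wi; lia.
    by rewrite wji.
  exists (i2, i3); first by rewrite TE lt23 b2 b3 orbT.
  by rewrite in_set /= lt23 w2 w3 ltn_add2l.
rewrite TE => /andP[ij vB]; split=> // t /=.
have [vji|vij] := boolP (v j < v i)%N.
  rewrite perm_matrix_transvection -[_ *m perm_matrix K v]mulmx1.
  by apply: cell_closure_borel => //; [apply: transvection_borel|apply: borel1].
move: vB; rewrite (negPf vij) /= !inE -!orbA.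
have v4' : v i2 = (p + 0)%N :> nat by rewrite addn0.
move=> /andP[] /or4P[] /eqP iE /or4P[] /eqP jE; rewrite iE jE in ij vij *.
all: try by [rewrite ltnn in ij | rewrite ltnNge ltnW in ij
            | rewrite v1 v4' ltn_add2l in vij | rewrite v3 v4 ltn_add2l in vij].
all: apply: cell_closure_transvection => //.
all: try by rewrite ?v1 ?v4' ?v3 ?v4 ltn_add2l.
- by apply: perm_ext Z4123 ; rewrite ?tE // => k kB; rewrite !permM !tout.
- by apply: perm_ext Z3142 ; rewrite ?tE // => k kB; rewrite !permM !tout.
- by apply: perm_ext Z2413 ; rewrite ?tE // => k kB; rewrite !permM !tout.
- by apply: perm_ext Z2341 ; rewrite ?tE // => k kB; rewrite !permM !tout.
Qed.

End SchubertVarieties.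

(** * Right cells *)

Lemma subseq_one_line n (w : 'S_n) (x1 x2 x3 x4 : nat) :
  subseq [:: x1; x2; x3; x4] (one_line w) ->
  exists i1 i2 i3 i4 : 'I_n, [/\ i1 < i2, i2 < i3 & i3 < i4] /\
    [/\ (w i1).+1 = x1, (w i2).+1 = x2, (w i3).+1 = x3 & (w i4).+1 = x4].
Proof.
case/subseqP=> m _; rewrite /one_line -map_mask.
have : sorted (relpre val ltn) (mask m (enum 'I_n)).
  apply: subseq_sorted (mask_subseq m _) _ => [i j k|]; first exact: ltn_trans.
  by rewrite -sorted_map val_enum_ord iota_ltn_sorted.
case: (mask m _) => [|i1 [|i2 [|i3 [|i4 [|//]]]]] //= /and4P[lt12 lt23 lt34 _].
by case=> -> -> -> ->; exists i1, i2, i3, i4.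
Qed.

Theorem proposition4p3 (K : closedFieldType) (n : nat) (P : tableau) (k : nat)
    (P_syt : is_syt n P) (P_two_columns : ncols P = 2)
    (P_rows : infix [:: [:: k - 2; k - 1]; [:: k; k + 1]; [:: k + 2; k + 3]] P) :
  (forall w : 'S_n, w \in right_cell n P -> ~ smooth K w) /\
  (forall w : 'S_n, w \in right_cell n P ->
     subseq [:: k + 2; k; k + 1; k - 1] (one_line w) /\
     has_pattern [:: k + 2; k; k + 1; k - 1] [:: 4; 2; 3; 1]).
Proof.
have [_ _ row_sorted _ P_iota] := P_syt.
have P_uniq : uniq (flatten P) by rewrite (perm_uniq P_iota) iota_uniq.
have [m km] : exists m, k = m + 3.
  have row : [:: k - 2; k - 1] \in P by apply: (mem_infix P_rows); rewrite mem_head.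
  have : k - 2 \in flatten P.
    by apply/flattenP; exists [:: k - 2; k - 1]; rewrite // mem_head.
  by rewrite (perm_mem P_iota) mem_iota => k2; exists (k - 3); lia.
have [k1 k2 k_1 k_2 k_3] : [/\ k - 2 = m + 1, k - 1 = m + 2, k + 1 = m + 4,
    k + 2 = m + 5 & k + 3 = m + 6] by split; lia.
rewrite k1 k2 k_1 k_2 k_3 km in P_rows *.
have pattern (w : 'S_n) : w \in right_cell n P ->
    subseq [:: m + 5; m + 3; m + 4; m + 2] (one_line w).
  rewrite inE => /eqP; exact: subseq_of_insertion_tableau.
split=> w /pattern sub; last first.
  split=> //; split=> // -[|[|[|[|i]]]] [|[|[|[|j]]]] //= _ _;
    by rewrite ltn_add2l.
have [i1 [i2 [i3 [i4 [[lt12 lt23 lt34] [w1 w2 w3 w4]]]]]] := subseq_one_line sub.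
by apply: (consecutive_4231_not_smooth (p := m + 1) lt12 lt23 lt34); lia.
Qed.
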